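(* Let $X$, $Y$ be Banach spaces over $\mathbb{K}$ ($\mathbb{R}$ or $\mathbb{C}$) and let $G\in L(X,Y)$ be an operator with the alternative Daugavet property. Then: (a) If $X^*$ is strictly convex, then $X=\mathbb{K}$ (i.e. $X$ is one-dimensional). (b) If $X^*$ is smooth, then $X=\mathbb{K}$. (c) If $Y^*$ is strictly convex, then $Y=\mathbb{K}$.
   Context: $\mathbb{T}=\{\omega\in\mathbb{K}:|\omega|=1\}$. $G\in L(X,Y)$ has the alternative Daugavet property if $\sup_{\omega\in\mathbb{T}}\|G+\omega T\|=1+\|T\|$ for every rank-one $T\in L(X,Y)$ (including $T=0$, so $\|G\|=1$). A Banach space $Z$ is strictly convex if every point of its unit sphere is an extreme point of its closed unit ball; it is smooth if for each $0\neq z\in Z$ there is a unique $z^*\in Z^*$ with $\|z^*\|=1$ and $z^*(z)=\|z\|$. *)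

(* Defs.v *)
From HB Require Import structures.
From mathcomp Require Import all_boot all_order all_algebra.
From mathcomp Require Import complex.
From mathcomp Require Import all_classical all_reals all_analysis.
Set Implicit Arguments.
Unset Strict Implicit.
Unset Printing Implicit Defensive.
Import Order.TTheory GRing.Theory Num.Theory.
Import numFieldNormedType.Exports.
Local Open Scope classical_set_scope.
Local Open Scope ring_scope.

Variant real_or_complex : numFieldType -> Prop :=
  | RealScalars (R : realType) : real_or_complex R
  | ComplexScalars (R : realType) : real_or_complex R[i].

Record scalarField := ScalarField {
  scalar_numField :> numFieldType;
  scalar_real_or_complex : real_or_complex scalar_numField }.

(* Norms take values in K itself. On R[i] the order relates only numbers with
   the same imaginary part, so for a nonempty set of real numbers bounded above
   the supremum for this order is the usual one. *)
Definition Ksup (K : numFieldType) (A : set K) : K := supremum 0 A.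

Lemma has_supremums (K : scalarField) (A : set K) (M : K) :
    A !=set0 -> (forall a, A a -> 0 <= a) -> ubound A M ->
  supremums A !=set0.
Proof.
case: K A M => K [] R /= A M A0 Apos ubM.
  have hA : has_sup A by split=> //; exists M.
  exists (sup A); split; first exact: sup_upper_bound.
  by move=> y; exact: ge_sup.
pose B := [set complex.Re z | z in A].
have AE a : A a -> a = (complex.Re a)%:C%C.
  by move=> /Apos a0; rewrite RRe_real// ger0_real.
have B0 : B !=set0 by case: A0 => a Aa; exists (complex.Re a), a.
have hB : has_sup B.
  split=> //; exists (complex.Re M) => _ [a Aa <-].
  by have := ubM _ Aa; rewrite lecE => /andP[].
exists (sup B)%:C%C; split=> [a Aa|y uby].
  rewrite (AE _ Aa) lecR; apply: sup_upper_bound => //.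
  by exists a.
have [a Aa] := A0.
rewrite lecE /=; apply/andP; split.
  by have := uby _ Aa; rewrite (AE _ Aa) lecE => /andP[].
apply: ge_sup => // _ [b Ab <-].
by have := uby _ Ab; rewrite lecE => /andP[].
Qed.

Section Ksup.
Variables (K : scalarField) (A : set K) (M : K).
Hypotheses (A0 : A !=set0) (Apos : forall a, A a -> 0 <= a) (ubM : ubound A M).

Let supA : supremums A (Ksup A).
Proof.
rewrite /Ksup /supremum ifF; last by apply/negbTE/set0P.
by apply: xgetPex; exact: (has_supremums A0 Apos ubM).
Qed.

Lemma Ksup_ub a : A a -> a <= Ksup A. Proof. by apply: supA.1. Qed.

Lemma Ksup_le N : ubound A N -> Ksup A <= N. Proof. by apply: supA.2. Qed.

End Ksup.

Section bounded_operators.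
Variables (K : scalarField) (X Y : normedModType K).

Definition is_bounded_operator : {pred X -> Y} :=
  [pred f | `[< linear f /\ continuous f >]].

Record bounded_operator := BoundedOperator {
  operator_fun :> X -> Y;
  operator_funP : operator_fun \in is_bounded_operator }.

HB.instance Definition _ := [isSub for operator_fun].
HB.instance Definition _ := [Choice of bounded_operator by <:].

Lemma is_bounded_operator_submod : submod_closed is_bounded_operator.
Proof.
split=> [|a f g /asboolP[lf cf] /asboolP[lg cg]]; apply/asboolP; split.
- by move=> a x y; rewrite /= scaler0 addr0.
- by move=> x; exact: cvg_cst.
- move=> b x y; rewrite !fctE lf lg !scalerDr !scalerA (mulrC a b).
  by rewrite addrACA.
- by move=> x; apply: cvgD; [apply: cvgZr; exact: cf|exact: cg].
Qed.

HB.instance Definition _ :=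
  GRing.isSubmodClosed.Build K (X -> Y) is_bounded_operator
    is_bounded_operator_submod.
HB.instance Definition _ := [SubChoice_isSubLmodule of bounded_operator by <:].

Lemma operator_linear (f : bounded_operator) : linear f.
Proof. by have /asboolP[] := operator_funP f. Qed.

Lemma operator_continuous (f : bounded_operator) : continuous f.
Proof. by have /asboolP[] := operator_funP f. Qed.

HB.instance Definition _ (f : bounded_operator) :=
  GRing.isLinear.Build K X Y *:%R (operator_fun f) (operator_linear f).

Definition operator_norm (f : bounded_operator) : K :=
  Ksup [set `|f x| | x in [set x | `|x| <= 1]].

Let S (f : bounded_operator) := [set `|f x| | x in [set x | `|x| <= 1]].

Let S0 f : S f !=set0.
Proof. by exists `|f 0|, 0 => //=; rewrite normr0. Qed.

Let Spos f (a : K) : S f a -> 0 <= a.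
Proof. by case=> x _ <-. Qed.

Let Subound f : exists M, ubound (S f) M.
Proof.
have /linear_bounded_continuous/bounded_funP/(_ 1)[M fM] :=
  operator_continuous (f := f).
by exists M => _ [x /= x1 <-]; exact: fM.
Qed.

Lemma operator_norm_ub (f : bounded_operator) (x : X) : `|x| <= 1 -> `|f x| <= operator_norm f.
Proof.
move=> x1; have [M fM] := Subound f.
by apply: (Ksup_ub (S0 f) (@Spos f) fM); exists x.
Qed.

Lemma operator_norm_le (f : bounded_operator) (N : K) :
  (forall x, `|x| <= 1 -> `|f x| <= N) -> operator_norm f <= N.
Proof.
move=> fN; have [M fM] := Subound f.
by apply: (Ksup_le (S0 f) (@Spos f) fM) => _ [x /= x1 <-]; exact: fN.
Qed.

Let normD (f g : bounded_operator) : operator_norm (f + g) <= operator_norm f + operator_norm g.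
Proof.
apply: operator_norm_le => x x1 /=; rewrite fctE (le_trans (ler_normD _ _))//.
by rewrite lerD// operator_norm_ub.
Qed.

Let norm_ge0 (f : bounded_operator) : 0 <= operator_norm f.
Proof. by apply: le_trans (operator_norm_ub f (x := 0) _); rewrite ?normr0. Qed.

Let normZ_le a (f : bounded_operator) : operator_norm (a *: f) <= `|a| * operator_norm f.
Proof.
apply: operator_norm_le => x x1 /=; rewrite fctE normrZ.
by rewrite ler_wpM2l// operator_norm_ub.
Qed.

Let norm0 : operator_norm 0 = 0.
Proof.
by apply/eqP; rewrite eq_le norm_ge0 andbT; apply: operator_norm_le => x _;
  rewrite /= normr0.
Qed.

Let normZ a (f : bounded_operator) : operator_norm (a *: f) = `|a| * operator_norm f.
Proof.
have [->|a0] := eqVneq a 0; first by rewrite scale0r norm0 normr0 mul0r.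
apply/eqP; rewrite eq_le normZ_le /= -ler_pdivlMl ?normr_gt0// -normfV.
by apply: le_trans (normZ_le _ _); rewrite scalerA mulVf// scale1r.
Qed.

Let norm_eq0 (f : bounded_operator) : operator_norm f = 0 -> f = 0.
Proof.
move=> f0; apply/val_inj/funext => x /=.
have [->|x0] := eqVneq x 0; first by rewrite raddf0.
have := @operator_norm_ub f (`|x|^-1 *: x).
rewrite f0 normrZ normfV normr_id mulVf ?normr_eq0// lexx => /(_ isT).
rewrite linearZ /= normr_le0 scaler_eq0 invr_eq0 normr_eq0 (negbTE x0) /=.
by move=> /eqP.
Qed.

HB.instance Definition _ :=
  Lmodule_isNormed.Build K bounded_operator normD normZ norm_eq0.

End bounded_operators.

Notation "''L' ( X , Y )" := (bounded_operator X Y)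
  (at level 8, format "''L' ( X ,  Y )") : type_scope.

Definition dual (K : scalarField) (X : normedModType K) : normedModType K :=
  'L(X, K^o).

Section geometry.
Variables (K : scalarField) (Z : normedModType K).

Definition extreme_point (C : set Z) (z : Z) : Prop :=
  C z /\ forall (x y : Z) (t : K), C x -> C y -> 0 < t < 1 ->
    z = t *: x + (1 - t) *: y -> x = y.

Definition strictly_convex : Prop :=
  forall z : Z, `|z| = 1 -> extreme_point [set x | `|x| <= 1] z.

Definition smooth : Prop :=
  forall z : Z, z != 0 -> exists! f : 'L(Z, K^o), `|f| = 1 /\ f z = `|z|.

Definition one_dimensional : Prop :=
  exists2 e : Z, e != 0 & forall z, exists k : K, z = k *: e.

End geometry.

Section alternative_Daugavet.
Variables (K : scalarField) (X Y : normedModType K).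

(* The zero operator is included. *)
Definition rank_one (T : 'L(X, Y)) : Prop :=
  exists y : Y, forall x, exists k : K, T x = k *: y.

Definition alternative_Daugavet (G : 'L(X, Y)) : Prop :=
  forall T : 'L(X, Y), rank_one T ->
    Ksup [set `|G + w *: T| | w in [set w : K | `|w| = 1]] = 1 + `|T|.

End alternative_Daugavet.

(* Main.v *)
(* For functionals f_n in the sphere of X* and y_0 in the sphere of Y, set
   y_{n+1} = y_n + 2^-(n+1) G x_n, where the alternative Daugavet property
   provides x_n in the ball of X such that |f_n x_n| is almost 1 and
   |y_{n+1}| is almost |y_n| + 2^-(n+1), with errors small compared to the
   remaining weights. A functional g of norm one norming the limit then satisfies
   g (G x_n) ~ 1. If each of two functionals occurs infinitely often in the
   sequence, compactness of the unit circle gives |G* g + w f| = 2 with |w| = 1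
   for both of them, and g y_0 <> 0.
   - If X* is strictly convex, then G* g is proportional to both functionals, so
     X* is one-dimensional.
   - If X* is smooth, let F norm h = G* g. For every f in the sphere, the same
     construction applied to h and f gives h' such that the norming functional
     of h' is proportional to F and is unimodular at f. Hence F is injective.
   - If Y* is strictly convex, the construction applied to f = G* g gives g'
     with |g' + w g| = 2, so g' is proportional to g, while g' y_0 <> 0 for a
     prescribed y_0. Hence g is injective. *)

Require Import Defs.
From HB Require Import structures.
From mathcomp Require Import all_boot all_order all_algebra.
From mathcomp Require Import complex ring lra.
From mathcomp Require Import all_classical all_reals all_analysis.

Set Implicit Arguments.
Unset Strict Implicit.
Unset Printing Implicit Defensive.
Import Order.TTheory GRing.Theory Num.Theory.
Import numFieldNormedType.Exports.
Local Open Scope classical_set_scope.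
Local Open Scope ring_scope.

(** * Minimal sublinear functionals over the reals *)

Section sublinear.
Variables (R : realType) (V : lmodType R).
Implicit Types (p q : V -> R) (x y : V).

(** Homogeneity is asked only as an inequality, a form that passes to infima; applying it to [r^-1]
    gives equality. *)
Definition sublinear q :=
  (forall x y, q (x + y) <= q x + q y) /\
  (forall r x, 0 < r -> q (r *: x) <= r * q x).

Lemma sublinear0 q : sublinear q -> q 0 = 0.
Proof.
move=> [qD qZ]; have := qD 0 0; have := qZ 2^-1 0.
rewrite addr0 scaler0 invr_gt0 ltr0n => /(_ isT); lra.
Qed.

Lemma sublinearZ q r x : sublinear q -> 0 <= r -> q (r *: x) = r * q x.
Proof.
move=> sq; rewrite le_eqVlt => /predU1P[<-|r0].
  by rewrite scale0r mul0r sublinear0.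
case: sq => _ qZ; apply/eqP; rewrite eq_le qZ//=.
rewrite -ler_pdivlMl// (le_trans _ (qZ _ _ _)) ?invr_gt0//.
by rewrite scalerA mulVf ?scale1r// gt_eqF.
Qed.

Lemma sublinear_geN q x y : sublinear q -> q x - q (- y) <= q (x + y).
Proof.
by move=> [qD _]; have := qD (x + y) (- y); rewrite addrK lerBlDr.
Qed.

Lemma inf_leD (A B C : set R) : A !=set0 -> B !=set0 -> has_lbound C ->
    (forall a b, A a -> B b -> exists2 c, C c & c <= a + b) ->
  inf C <= inf A + inf B.
Proof.
move=> A0 B0 lC ABC; rewrite -lerBlDl; apply: lb_le_inf => // b Bb.
rewrite lerBlDl -lerBlDr; apply: lb_le_inf => // a Aa; rewrite lerBlDr.
by have [c Cc] := ABC _ _ Aa Bb; apply: le_trans; exact: ge_inf.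
Qed.

Lemma inf_leM (r : R) (A C : set R) : 0 < r -> A !=set0 -> has_lbound C ->
  (forall a, A a -> exists2 c, C c & c <= r * a) -> inf C <= r * inf A.
Proof.
move=> r0 A0 lC AC; rewrite -ler_pdivrMl//; apply: lb_le_inf => // a Aa.
rewrite ler_pdivrMl//; have [c Cc] := AC _ Aa.
by apply: le_trans; exact: ge_inf.
Qed.

(** The infimum is finite because sublinearity bounds each [s x] below by [- p (- x)]. For
    subadditivity, the infima at [x] and [y] may be approached by different members of the chain;
    the smaller of the two serves for both. *)
Lemma chain_inf_sublinear p (A : set (V -> R)) : A !=set0 ->
    (forall q, A q -> sublinear q /\ forall x, q x <= p x) ->
    (forall s t, A s -> A t -> (forall x, t x <= s x) \/ (forall x, s x <= t x)) ->
  exists q, [/\ sublinear q, forall x, q x <= p x &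
                forall s x, A s -> q x <= s x].
Proof.
move=> [s0 As0] AP chA.
pose S x := [set s x | s in A].
have S0 x : S x !=set0 by exists (s0 x), s0.
have lS x : has_lbound (S x).
  exists (- p (- x)) => _ [s As <-]; have [subs sp] := AP _ As.
  have := sublinear_geN x (- x) subs; rewrite subrr sublinear0// opprK.
  by have := sp (- x); have := sublinear_geN 0 x subs;
    rewrite add0r sublinear0// sub0r; lra.
have Sle s x : A s -> inf (S x) <= s x.
  by move=> As; apply: ge_inf => //; exists s.
exists (fun x => inf (S x)); split=> //; last first.
  by move=> x; apply: le_trans (Sle _ _ As0) _; apply: (AP _ As0).2.
split=> [x y|r x r0].
  apply: inf_leD => // _ _ [s As <-] [t At <-].
  have [[sD _] _] := AP _ As; have [[tD _] _] := AP _ At.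
  have [ts|st] := chA _ _ As At.
    by exists (t (x + y)); [exists t|rewrite (le_trans (tD _ _))// lerD2r].
  by exists (s (x + y)); [exists s|rewrite (le_trans (sD _ _))// lerD2l].
apply: inf_leM => // _ [s As <-]; exists (s (r *: x)); first by exists s.
by have [[_ sZ] _] := AP _ As; exact: sZ.
Qed.

(* The largest sublinear functional below [q] whose value at [- x] is at most
   [- q x]. *)
Lemma sublinear_tilt q x : sublinear q ->
  exists q', [/\ sublinear q', forall y, q' y <= q y & q' (- x) <= - q x].
Proof.
move=> sq; have [qD qZ] := sq.
pose S y := [set q (y + t *: x) - t * q x | t in [set t | 0 <= t]].
have Sle y t : 0 <= t -> S y (q (y + t *: x) - t * q x) by move=> t0; exists t.
have S0 y : S y !=set0 by exists (q (y + 0 *: x) - 0 * q x); exact: Sle.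
have lS y : has_lbound (S y).
  exists (- q (- y)) => _ [t t0 <-].
  have := sublinear_geN (t *: x) y sq.
  by rewrite sublinearZ// [_ + y]addrC; lra.
exists (fun y => inf (S y)); split; last first.
- apply: ge_inf => //; exists 1 => //=.
  by rewrite scale1r addNr mul1r sublinear0// sub0r.
- move=> y; apply: ge_inf => //; exists 0 => //=.
  by rewrite scale0r addr0 mul0r subr0.
split=> [y z|r y r0].
  apply: inf_leD => // _ _ [s s0 <-] [t t0 <-].
  exists (q (y + z + (s + t) *: x) - (s + t) * q x).
    by apply: Sle; rewrite addr_ge0.
  have := qD (y + s *: x) (z + t *: x); rewrite addrACA -scalerDl; lra.
apply: inf_leM => // _ [s s0 <-].
exists (q (r *: y + (r * s) *: x) - (r * s) * q x).
  by apply: Sle; rewrite mulr_ge0// ltW.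
have := qZ r (y + s *: x) r0; rewrite scalerDr scalerA; lra.
Qed.

(* A minimal sublinear functional is its own tilt in every direction, hence
   linear. *)
Lemma exists_linear_below p x0 : sublinear p ->
  exists q, [/\ forall x y, q (x + y) = q x + q y,
                forall r x, q (r *: x) = r * q x,
                forall x, q x <= p x & q x0 = p x0].
Proof.
(* Tilting at [x0] before minimizing gives [q (- x0) <= - p x0] for every [q] below [p']; for a
   linear [q] this yields [q x0 = p x0]. *)
move=> sp; have [p' [sp' p'p p'x0]] := sublinear_tilt x0 sp.
pose T := {q : V -> R | sublinear q /\ forall x, q x <= p' x}.
(* [Rel s t] says that [t <= s] pointwise, so a maximal element in Zorn's lemma is a minimal
   functional. *)
pose Rel (s t : T) := `[< forall x, sval t x <= sval s x >].
have p'T : sublinear p' /\ forall x, p' x <= p' x by [].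
have [||A totA|q qmin] := @ZL_preorder T (exist _ p' p'T) Rel.
- by move=> t; apply/asboolP.
- move=> r s t /asboolP rs /asboolP st; apply/asboolP => x.
  exact: le_trans (st x) (rs x).
- have [[s As]|A0] := pselect (A !=set0); last first.
    by exists (exist _ p' p'T) => s As; exfalso; apply: A0; exists s.
  have [|||q [sq qp qA]] := @chain_inf_sublinear p' [set sval s | s in A].
  + by exists (sval s), s.
  + by move=> _ [t _ <-]; exact: (svalP t).
  + move=> _ _ [t At <-] [u Au <-].
    by case: (totA _ _ At Au) => /asboolP; [left|right].
  by exists (exist _ q (conj sq qp)) => t At; apply/asboolP => x /=; apply: qA;
    exists t.
case: q qmin => q [sq qp'] qmin; have [qD qZ] := sq.
(* Minimality gives [q <= q'], so [q y <= q' (y + x) + q' (- x) <= q (y + x) - q x]. *)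
have tilt x y : q y + q x <= q (y + x).
  have [q' [sq' q'q q'x]] := sublinear_tilt x sq.
  have q'T : sublinear q' /\ forall x, q' x <= p' x.
    by split=> // z; exact: le_trans (q'q z) (qp' z).
  have /asboolP/= qq' : Rel (exist _ q' q'T) (exist _ q (conj sq qp')).
    by apply: qmin; apply/asboolP.
  have := qq' y; have [q'D _] := sq'.
  have := q'D (y + x) (- x); rewrite addrK; have := q'q (y + x); lra.
have addq x y : q (x + y) = q x + q y by apply/eqP; rewrite eq_le qD tilt.
have q0 := sublinear0 sq.
have oppq x : q (- x) = - q x.
  by have := addq x (- x); rewrite subrr q0; lra.
exists q; split=> //.
- move=> r x; have [r0|r0] := leP 0 r; first exact: sublinearZ.
  have := @sublinearZ q (- r) x sq; rewrite scaleNr oppq; lra.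
- by move=> x; exact: le_trans (qp' x) (p'p x).
- have := qp' (- x0); have := qp' x0; have := p'p x0; rewrite oppq; lra.
Qed.

End sublinear.

(** * The real and complex Hahn-Banach theorems *)

Section restriction_of_scalars.
Variables (R : realType) (V : lmodType R[i]).

(** An alias, so that the real scaling does not clash with the complex scaling carried by [V]. *)
Definition realified : Type := V.

HB.instance Definition _ := GRing.Zmodule.on realified.

Let realified_scale (r : R) (v : realified) : realified := r%:C%C *: (v : V).

Fact realified_scaleA a b v :
  realified_scale a (realified_scale b v) = realified_scale (a * b) v.
Proof. by rewrite /realified_scale scalerA -rmorphM. Qed.

Fact realified_scale1 : left_id 1 realified_scale.
Proof. by move=> v; rewrite /realified_scale rmorph1 scale1r. Qed.

Fact realified_scaleDr : right_distributive realified_scale +%R.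
Proof. by move=> a u v; rewrite /realified_scale scalerDr. Qed.

Fact realified_scaleDl v : {morph realified_scale^~ v : a b / a + b}.
Proof. by move=> a b; rewrite /realified_scale rmorphD scalerDl. Qed.

HB.instance Definition _ := GRing.Zmodule_isLmodule.Build R realified
  realified_scaleA realified_scale1 realified_scaleDr realified_scaleDl.

End restriction_of_scalars.

Lemma hahn_banach_real (R : realType) (X : normedModType R) (x0 : X) :
  exists f : X -> R, [/\ forall a x y, f (a *: x + y) = a * f x + f y,
    forall x, `|f x| <= `|x| & f x0 = `|x0|].
Proof.
have snorm : sublinear (fun x : X => `|x|).
  by split=> [x y|r x r0]; [exact: ler_normD|rewrite normrZ gtr0_norm].
have [f [fD fZ fle fx0]] := exists_linear_below x0 snorm.
exists f; split=> // [a x y|x]; first by rewrite fD fZ.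
rewrite ler_norml fle andbT; have := fle (- x).
by rewrite -scaleN1r fZ normrZ normrN1 !mul1r mulN1r; lra.
Qed.

(** From [Re z ^+ 2 + Im z ^+ 2 <= r ^+ 2] the imaginary part vanishes. This upgrades equalities of
    real parts to equalities of complex numbers. *)
Lemma complex_eq_norm (R : realType) (z : R[i]) (r : R) :
  `|z| <= r%:C%C -> complex.Re z = r -> z = r%:C%C.
Proof.
case: z => a b /= zr arE; rewrite arE in zr *.
have : `|r +i* b|%C ^+ 2 <= (r%:C%C) ^+ 2.
  by rewrite lerXn2r// nnegrE// (le_trans _ zr).
rewrite -add_Re2_Im2 -rmorphXn lecR /= => h.
have /eqP : b ^+ 2 = 0 by have := sqr_ge0 b; lra.
by rewrite sqrf_eq0 => /eqP ->.
Qed.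

(* A complex functional is determined by its real part [g], as
   [g x - i g (i x)]. *)
Lemma hahn_banach_complex (R : realType) (X : normedModType R[i]) (x0 : X) :
  exists f : X -> R[i], [/\ forall a x y, f (a *: x + y) = a * f x + f y,
    forall x, `|f x| <= `|x| & f x0 = `|x0|].
Proof.
pose p (x : realified X) : R := complex.Re `|x : X|.
have pE x : `|x : X| = (p x)%:C%C by rewrite /p RRe_real// normr_real.
have pD (x y : X) : p (x + y) <= p x + p y.
  by rewrite -lecR [leRHS]rmorphD /= -!pE ler_normD.
have pZ (r : R) (x : X) : 0 < r -> p (r%:C%C *: x) <= r * p x.
  move=> r0; rewrite -lecR [leRHS]rmorphM /= -!pE normrZ.
  by rewrite ger0_norm// ler0c ltW.
have sp : sublinear p by split=> [x y|r x]; [exact: pD|exact: pZ].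
have [g [gD gZ gle gx0]] := exists_linear_below (x0 : realified X) sp.
have gD' (x y : X) : g (x + y) = g x + g y by exact: gD.
pose f (x : X) : R[i] := (g x -i* g ('i%C *: x))%C.
have fD x y : f (x + y) = f x + f y.
  by rewrite /f scalerDr !gD'; apply/eqP; rewrite eq_complex /= opprD !eqxx.
have gZ' (r : R) (x : X) : g (r%:C%C *: x) = r * g x by exact: gZ.
have fZR (r : R) x : f (r%:C%C *: x) = r%:C%C * f x.
  rewrite /f scalerA mulrC -scalerA !gZ'; apply/eqP.
  by rewrite eq_complex /=; apply/andP; split; apply/eqP; ring.
have gN (x : X) : g (- x) = - g x.
  by have := gZ' (- 1) x; rewrite rmorphN1 scaleN1r mulN1r.
have fZi x : f ('i%C *: x) = 'i%C * f x.
  rewrite /f scalerA.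
  have -> : 'i%C * 'i%C = -1 :> R[i] by rewrite -expr2 sqr_i.
  rewrite scaleN1r gN; apply/eqP.
  by rewrite eq_complex /=; apply/andP; split; apply/eqP; ring.
have fZ a x : f (a *: x) = a * f x.
  by rewrite [a]complexE scalerDl fD -scalerA fZi !fZR mulrDl mulrA.
have fle x : `|f x| <= `|x|.
  have [->|fx0] := eqVneq (f x) 0; first by rewrite normr0.
  (* Rotating by the unimodular [u] makes the value of [f] real, hence equal to its real part [g],
     which [p] dominates. *)
  pose u := `|f x| / f x.
  have u1 : `|u| = 1 by rewrite normrM normfV normr_id mulfV// normr_eq0.
  have fu : f (u *: x) = `|f x| by rewrite fZ mulfVK.
  rewrite -[leRHS]mul1r -u1 -normrZ -fu pE.
  have : f (u *: x) \is Num.real by rewrite fu normr_real.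
  by move=> /RRe_real <-; rewrite lecR; exact: gle.
exists f; split=> // [a x y|]; first by rewrite fD fZ.
by rewrite pE; apply: complex_eq_norm; rewrite -?pE.
Qed.

Lemma scalar_hahn_banach (K : scalarField) (X : normedModType K) (x0 : X) :
  exists f : X -> K, [/\ forall a x y, f (a *: x + y) = a * f x + f y,
    forall x, `|f x| <= `|x| & f x0 = `|x0|].
Proof.
case: K X x0 => K [] R /= X x0; first exact: hahn_banach_real.
exact: hahn_banach_complex.
Qed.

(** * Small dyadic numbers and cluster points on the unit circle *)

Lemma exp_half_lt (K : scalarField) (e : K) :
  0 < e -> exists n, 2^-1 ^+ n < e.
Proof.
have real_case (R : realType) (r : R) : 0 < r -> exists n, 2^-1 ^+ n < r.
  move=> r0; have [n nr] : exists n : nat, r^-1 < n%:R.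
    by exists (Num.bound r^-1); rewrite archi_boundP// invr_ge0 ltW.
  exists n; rewrite exprVn invf_plt ?posrE ?exprn_gt0//.
  by rewrite (lt_le_trans nr)// -natrX ler_nat ltnW// ltn_expl.
case: K e => K [] R /= e e0; first exact: real_case.
have /RRe_real eE : e \is Num.real by exact: gtr0_real.
have [|n ne] := real_case R (complex.Re e); first by rewrite -ltcR eE.
exists n; rewrite -eE.
by rewrite (_ : 2^-1 ^+ n = (2^-1 ^+ n)%:C%C) ?ltcR// rmorphXn fmorphV rmorph_nat.
Qed.

(** Real and imaginary parts range over a compact square; for real scalars the second coordinate is
    the constant 0. *)
Lemma circle_cluster (K : scalarField) (w : nat -> K) : (forall n, `|w n| = 1) ->
  exists l, forall e, 0 < e -> forall N, exists2 n, (N <= n)%N & `|l - w n| < e.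
Proof.
have cluster_pair (R : realType) (u v : nat -> R) :
    (forall n, `|u n| <= 1) -> (forall n, `|v n| <= 1) ->
  exists l : R * R, forall e, 0 < e -> forall N, exists2 n, (N <= n)%N &
    `|l.1 - u n| < e /\ `|l.2 - v n| < e.
  move=> u1 v1.
  have cS : compact (`[-1, 1] `*` `[-1, 1] : set (R * R)).
    by apply: compact_setX; exact: segment_compact.
  have [|l [_ lc]] := cS ((fun n => (u n, v n)) @ \oo) _.
    by exists 0 => // n _; split=> /=; rewrite in_itv /= -ler_norml.
  exists l => e e0 N.
  have [|_ [[n Nn <-] [/= ]]] := lc [set (u n, v n) | n in [set n | (N <= n)%N]] (ball l e) _ (nbhsx_ballx _ _ e0).
    by exists N => // n /= Nn; exists n.
  by move=> h1 h2; exists n.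
case: K w => K [] R /= w w1.
  have [||l lP] := cluster_pair R w (fun=> 0).
  - by move=> n; rewrite w1.
  - by move=> n; rewrite normr0.
  - by exists l.1 => e e0 N; have [n Nn []] := lP _ e0 N; exists n.
have [||l lP] := cluster_pair R (fun n => complex.Re (w n)) (fun n => complex.Im (w n)).
- by move=> n; rewrite -lecR; apply: le_trans (normc_ge_Re _) _; rewrite w1.
- move=> n; rewrite -lecR -normrN -ReiNIm; apply: le_trans (normc_ge_Re _) _.
  by rewrite normrM w1 mul1r normc_def /= expr0n /= add0r expr1n sqrtr1.
exists (l.1 +i* l.2)%C => e e0 N.
have /RRe_real eE : e \is Num.real by exact: gtr0_real.
have e20 : 0 < complex.Re e / 2 by rewrite divr_gt0// -ltcR eE.
have [n Nn [n1 n2]] := lP _ e20 N; exists n => //.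
rewrite [ltLHS](_ : _ = `|(l.1 - complex.Re (w n))%:C%C + 'i%C * (l.2 - complex.Im (w n))%:C%C|); last first.
  by rewrite [w n]complexE; congr (`|_|); apply/eqP; rewrite eq_complex /=;
     apply/andP; split; apply/eqP; ring.
apply: le_lt_trans (ler_normD _ _) _.
rewrite normrM (_ : `|'i%C| = 1) ?mul1r; last first.
  by rewrite normc_def /= expr0n /= add0r expr1n sqrtr1.
rewrite !normc_def /= expr0n /= !addr0 !sqrtr_sqr -rmorphD -eE ltcR.
by rewrite [ltRHS](splitr (complex.Re e)) ltrD.
Qed.

(** * Operators, functionals and their norms *)

Section operators.
Variable K : scalarField.
Implicit Types X Y Z : normedModType K.

Lemma operator_exists X Y (f : X -> Y) (M : K) : linear f ->
  (forall x, `|f x| <= M * `|x|) -> exists F : 'L(X, Y), forall x, F x = f x.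
Proof.
move=> lf fM.
pose fL := HB.pack_for {linear X -> Y} f (GRing.isLinear.Build K X Y *:%R f lf).
have cf : continuous f.
  apply/(@linear_bounded_continuous _ _ _ fL)/bounded_funP => r.
  exists (`|M| * r) => x xr.
  have := fM x; rewrite -[leLHS]normr_id -[leRHS]ger0_norm; last first.
    by rewrite (le_trans _ (fM x)).
  by rewrite normr_id normrM normr_id => /le_trans; apply; rewrite ler_wpM2l.
by exists (@BoundedOperator K X Y f (asboolT (conj lf cf))).
Qed.

Lemma ler_operator X Y (f : 'L(X, Y)) x : `|f x| <= `|f| * `|x|.
Proof.
have [->|x0] := eqVneq x 0; first by rewrite raddf0 !normr0 mulr0.
rewrite -ler_pdivrMr ?normr_gt0// mulrC.
have := @operator_norm_ub K X Y f (`|x|^-1 *: x).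
rewrite linearZ /= !normrZ normfV normr_id mulVf ?normr_eq0//.
by apply.
Qed.

Lemma ler_operator1 X Y (f : 'L(X, Y)) x : `|x| <= 1 -> `|f x| <= `|f|.
Proof. exact: operator_norm_ub. Qed.

Lemma ler_ball X Y (f : 'L(X, Y)) x : `|f| <= 1 -> `|f x| <= `|x|.
Proof.
by move=> f1; apply: le_trans (ler_operator _ _) _; rewrite ler_piMl.
Qed.

Lemma operator_approx X Y (f : 'L(X, Y)) (e : K) : 0 < e ->
  exists2 x, `|x| <= 1 & `|f| - e < `|f x|.
Proof.
move=> e0; have [//|nx] := pselect (exists2 x, `|x| <= 1 & `|f| - e < `|f x|).
have : `|f| <= `|f| - e.
  apply: operator_norm_le => x x1.
  have r : `|f| - e \is Num.real by rewrite rpredB ?normr_real ?gtr0_real.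
  rewrite real_leNgt ?normr_real//; apply/negP => h; apply: nx; by exists x.
by rewrite lerDl oppr_ge0 => /(lt_le_trans e0); rewrite ltxx.
Qed.

Lemma hahn_banach X (x0 : X) : exists f : 'L(X, K^o), `|f| <= 1 /\ f x0 = `|x0|.
Proof.
have [f [fl fle fx0]] := scalar_hahn_banach x0.
have [|F FE] := @operator_exists X K^o f 1 fl.
  by move=> x; rewrite mul1r; exact: fle.
exists F; rewrite FE; split=> //.
by apply: operator_norm_le => x x1; rewrite FE (le_trans (fle x)).
Qed.

Lemma hahn_banach1 X (x0 : X) : x0 != 0 ->
  exists f : 'L(X, K^o), `|f| = 1 /\ f x0 = `|x0|.
Proof.
move=> x00; have [f [f1 fx0]] := hahn_banach x0; exists f; split=> //.
apply/eqP; rewrite eq_le f1 /=.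
have := ler_operator f x0; rewrite fx0 normr_id.
by rewrite -[leLHS]mul1r ler_pM2r ?normr_gt0.
Qed.

Lemma operator_comp X Y Z (g : 'L(Y, Z)) (f : 'L(X, Y)) :
  exists2 h : 'L(X, Z), forall x, h x = g (f x) & `|h| <= `|g| * `|f|.
Proof.
have [||h hE] := @operator_exists X Z (fun x => g (f x)) (`|g| * `|f|).
- by move=> a x y; rewrite linearP linearP.
- move=> x; apply: le_trans (ler_operator _ _) _.
  by rewrite -mulrA ler_wpM2l// ler_operator.
exists h => //; apply: operator_norm_le => x x1; rewrite hE.
apply: le_trans (ler_operator _ _) _; rewrite ler_wpM2l//.
exact: ler_operator1.
Qed.

Lemma rank_one_exists X Y (f : 'L(X, K^o)) (y : Y) :
  exists T : 'L(X, Y), [/\ forall x, T x = f x *: y, rank_one T &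
                           `|f| * `|y| <= `|T|].
Proof.
have [||T TE] := @operator_exists X Y (fun x => f x *: y) (`|f| * `|y|).
- by move=> a u v; rewrite linearP /= scalerDl -scalerA.
- by move=> x; rewrite normrZ mulrAC ler_wpM2r// ler_operator.
exists T; split=> //; first by exists y => x; exists (f x).
have [->|y0] := eqVneq y 0; first by rewrite normr0 mulr0.
rewrite -ler_pdivlMr ?normr_gt0//; apply: operator_norm_le => x x1.
by rewrite ler_pdivlMr ?normr_gt0// -normrZ -TE ler_operator1.
Qed.

Lemma operator_add X Y (f g : 'L(X, Y)) x : (f + g) x = f x + g x.
Proof. by []. Qed.

Lemma operator_scale X Y (f : 'L(X, Y)) k x : (k *: f) x = k *: f x.
Proof. by []. Qed.

End operators.

(** * One step of the construction *)

Section alternative_Daugavet.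
Variables (K : scalarField) (X Y : normedModType K) (G : 'L(X, Y)).
Hypothesis hG : alternative_Daugavet G.

Lemma aD_approx (T : 'L(X, Y)) (e : K) : rank_one T -> 0 < e ->
  exists2 w : K, `|w| = 1 & 1 + `|T| - e < `|G + w *: T|.
Proof.
move=> rT e0; have := hG rT; set S := [set _ | _ in _] => SE.
have [//|nw] := pselect (exists2 w : K, `|w| = 1 & 1 + `|T| - e < `|G + w *: T|).
have : Ksup S <= 1 + `|T| - e.
  apply: (@Ksup_le K S (`|G| + `|T|)).
  - by exists `|G + 1 *: T|, 1 => //=; rewrite normr1.
  - by move=> _ [w _ <-].
  - move=> _ [w /= w1 <-]; apply: le_trans (ler_normD _ _) _.
    by rewrite normrZ w1 mul1r.
  move=> _ [w /= w1 <-].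
  have r : 1 + `|T| - e \is Num.real.
    by rewrite rpredB ?gtr0_real// rpredD ?normr_real ?rpred1.
  by rewrite real_leNgt ?normr_real//; apply/negP => h; apply: nw; exists w.
by rewrite SE lerDl oppr_ge0 => /(lt_le_trans e0); rewrite ltxx.
Qed.

(** With [T = 0] every [G + w *: T] is [G], so the supremum, equal to 1, bounds [|G|]. *)
Lemma aD_norm_le1 : `|G| <= 1.
Proof.
have r0 : rank_one (0 : 'L(X, Y)) by exists 0 => x; exists 0; rewrite scaler0.
have := hG r0; rewrite normr0 addr0 => <-.
apply: (@Ksup_ub K _ `|G|).
- by exists `|G + 1 *: 0|, 1 => //=; rewrite normr1.
- by move=> _ [w _ <-].
- by move=> _ [w _ <-]; rewrite scaler0 addr0.
- by exists 1; rewrite /= ?normr1// scaler0 addr0.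
Qed.

(** The property is applied to the operator sending [x] to [f x / a *: y], of norm at least
    [|y| / a]. At a nearly norming [x], the vector [a G x + w f(x) y] has norm almost [a + |y|].
    Since [1 <= |y|], this forces [|f x|] to be almost 1, so after a rotation [w f(x) y] may be
    replaced by [y]. The approximation and the replacement each cost at most [a * d]. *)
Lemma aD_step (f : 'L(X, K^o)) (y : Y) (a d : K) :
    `|f| = 1 -> 0 < a -> a <= 1 -> 1 <= `|y| -> 0 < d ->
  exists x : X, exists w : K, [/\ `|x| <= 1, `|w| = 1, 1 - d <= w * f x &
    `|y| + a - 2 * a * d <= `|y + a *: G x|].
Proof.
move=> f1 a0 a1 y1 d0; have an0 : a != 0 by rewrite gt_eqF.
have ya : `|a^-1 *: y| = `|y| / a.
  by rewrite normrZ normfV gtr0_norm// mulrC.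
have [T [TE rT nT]] := rank_one_exists f (a^-1 *: y).
rewrite f1 mul1r ya in nT.
have [|w w1 wT] := @aD_approx T (d / 2) rT; first by rewrite divr_gt0.
have [|x x1 xT] := @operator_approx _ _ _ (G + w *: T) (d / 2).
  by rewrite divr_gt0.
have big : a + `|y| - a * d < `|a *: G x + (w * f x) *: y|.
  have -> : a *: G x + (w * f x) *: y = a *: (G + w *: T) x.
    rewrite operator_add operator_scale TE scalerDr !scalerA.
    by congr (_ + _ *: _); field.
  rewrite normrZ gtr0_norm// -ltr_pdivrMl//.
  rewrite (_ : a^-1 * _ = 1 + `|y| / a - d); last by field.
  apply: le_lt_trans xT; rewrite [d in leLHS]splitr opprD addrA lerD2r.
  by rewrite (le_trans _ (ltW wT))// lerD2r lerD2l.
(* The phase [u] is absorbed into [x], which turns [w * f x] into its modulus. *)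
have [u u1 uc] : exists2 u : K, `|u| = 1 & u * (w * f x) = `|w * f x|.
  have [->|c0] := eqVneq (w * f x) 0.
    by exists 1; rewrite ?normr1// mulr0 normr0.
  exists (`|w * f x| / (w * f x)); last by rewrite divfK.
  by rewrite normrM normfV normr_id mulfV// normr_eq0.
set s := `|w * f x| in uc.
have s1 : s <= 1 by rewrite /s normrM w1 mul1r -f1 ler_operator1.
have Gs : a *: G (u *: x) + s *: y = u *: (a *: G x + (w * f x) *: y).
  by rewrite linearZ scalerDr !scalerA mulrC uc.
have sbig : a + `|y| - a * d < `|a *: G (u *: x) + s *: y|.
  by rewrite Gs normrZ u1 mul1r.
have s0 : 0 <= s by rewrite /s.
have Gux : `|G (u *: x)| <= 1.
  apply: le_trans (ler_ball _ aD_norm_le1) _.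
  by rewrite normrZ u1 mul1r.
(* The upper bound [a + s |y|] for the norm in [sbig] is compared with the lower one. *)
have sy : (1 - s) * `|y| <= a * d.
  have := ltW (lt_le_trans sbig (ler_normD _ _)).
  rewrite !normrZ (gtr0_norm a0) (ger0_norm s0) -subr_ge0 => h.
  rewrite -subr_ge0.
  have -> : a * d - (1 - s) * `|y| = a * (1 - `|G (u *: x)|) +
    (a * `|G (u *: x)| + s * `|y| - (a + `|y| - a * d)) by ring.
  by rewrite addr_ge0// mulr_ge0 ?subr_ge0// ltW.
exists (u *: x), w; split=> //.
- by rewrite normrZ u1 mul1r.
- rewrite linearZ /= mulrCA uc lerBlDl -lerBlDr.
  have h1 : (1 - s) * 1 <= (1 - s) * `|y| by rewrite ler_wpM2l// subr_ge0.
  rewrite mulr1 in h1; apply: le_trans h1 (le_trans sy _).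
  by rewrite ler_piMl// ltW.
have := ler_normB (y + a *: G (u *: x)) ((1 - s) *: y).
rewrite (_ : _ - (1 - s) *: y = a *: G (u *: x) + s *: y); last first.
  by rewrite scalerBl scale1r opprB addrC addrA subrK addrC.
rewrite normrZ ger0_norm ?subr_ge0// => h.
rewrite -subr_ge0.
have -> : `|y + a *: G (u *: x)| - (`|y| + a - 2 * a * d) =
  (`|a *: G (u *: x) + s *: y| - (a + `|y| - a * d)) +
  (a * d - (1 - s) * `|y|) +
  (`|y + a *: G (u *: x)| + (1 - s) * `|y| - `|a *: G (u *: x) + s *: y|) by ring.
by apply: addr_ge0; [apply: addr_ge0|]; rewrite subr_ge0 // ltW.
Qed.

End alternative_Daugavet.

(** * Dyadic weights and limits along them *)

Section half_powers.
Variable K : scalarField.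

Definition half (n : nat) : K := 2^-1 ^+ n.

Lemma half_gt0 n : 0 < half n.
Proof. by rewrite exprn_gt0// invr_gt0. Qed.

Lemma half_le1 n : half n <= 1.
Proof. by rewrite exprn_ile1// ?invr_ge0// invf_le1// ler1n. Qed.

Lemma halfS n : half n.+1 = half n / 2.
Proof. by rewrite /half exprSr. Qed.

Lemma half_le m n : (m <= n)%N -> half n <= half m.
Proof. by move=> mn; rewrite ler_wiXn2l ?invr_ge0// invf_le1// ler1n. Qed.

(** The bounds on the increments from [n] to [n + k] add up to [half n - half (n + k)]; so the
    sequence is Cauchy, and the bound [half n] survives in the limit. *)
Lemma half_cvg (Y : completeNormedModType K) (y : nat -> Y) :
    (forall n, `|y n.+1 - y n| <= half n.+1) ->
  exists l, forall n, `|l - y n| <= half n.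
Proof.
move=> yS.
have yD n k : `|y (n + k)%N - y n| <= half n - half (n + k).
  elim: k => [|k IH]; first by rewrite addn0 !subrr normr0.
  rewrite addnS -(subrKA (y (n + k)%N)) (le_trans (ler_normD _ _))//.
  apply: le_trans (lerD (yS _) IH) _.
  by rewrite halfS -subr_ge0 (_ : _ - _ = 0)//; field.
have yle n m : (n <= m)%N -> `|y m - y n| <= half n.
  move=> /subnKC <-; apply: le_trans (yD _ _) _.
  by rewrite gerBl ltW// half_gt0.
have cy : cvg (y @ \oo).
  apply/cauchy_cvgP/cauchy_exP => e e0.
  have [n ne] := exp_half_lt e0; exists (y n), n => // m /= nm.
  by rewrite -ball_normE /= distrC (le_lt_trans (yle _ _ nm)).
exists (lim (y @ \oo)) => n; apply/ler_addgt0Pl => e e0.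
have /cvgrPdist_lt/(_ _ e0)[N _ Ne] := cy.
rewrite -(subrKA (y (maxn N n))) (le_trans (ler_normD _ _))// lerD//.
  by apply/ltW/Ne; rewrite /= leq_maxl.
by rewrite yle// leq_maxr.
Qed.

End half_powers.

(** Phases [w n] with deficit [half n] cluster at some [l] on the unit circle, and replacing [w n]
    by [l] changes the norm by at most [|l - w n|]. Then [2 <= |h| + 1] forces [|h| = 1]. *)
Lemma aligned_attained (K : scalarField) (Z : normedModType K) (h f : Z) :
    `|h| <= 1 -> `|f| = 1 ->
    (forall e : K, 0 < e -> exists2 w : K, `|w| = 1 & 2 - e <= `|h + w *: f|) ->
  `|h| = 1 /\ exists2 w : K, `|w| = 1 & `|h + w *: f| = 2.
Proof.
move=> h1 f1 hf.
have /choice[w wP] : forall n, exists w : K, `|w| = 1 /\ 2 - half K n <= `|h + w *: f|.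
  by move=> n; have [w] := hf _ (half_gt0 K n); exists w.
have [l lP] := @circle_cluster K w (fun n => (wP n).1).
have l1 : `|l| = 1.
  apply/eqP; rewrite eq_le; apply/andP; split; apply/ler_addgt0Pl => e e0.
    have [n _ ln] := lP _ e0 0%N.
    rewrite -(wP n).1 -lerBlDr (le_trans (lerB_dist _ _))// ltW//.
  have [n _ ln] := lP _ e0 0%N.
  by rewrite -(wP n).1 -lerBlDr (le_trans (lerB_dist _ _))// distrC ltW.
have hl : `|h + l *: f| = 2.
  apply/eqP; rewrite eq_le; apply/andP; split.
    by rewrite (le_trans (ler_normD _ _))// normrZ l1 f1 mul1r lerD.
  apply/ler_addgt0Pl => e e0.
  have e20 : 0 < e / 2 by rewrite divr_gt0.
  have [N Ne] := exp_half_lt e20; have [n Nn ln] := lP _ e20 N.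
  have := (wP n).2; rewrite lerBlDl => /le_trans; apply.
  rewrite [e]splitr -addrA lerD//.
    by rewrite (le_trans (half_le _ Nn))// ltW.
  have -> : h + w n *: f = (w n - l) *: f + (h + l *: f).
    by rewrite scalerBl [h + l *: f]addrC addrA subrK addrC.
  rewrite (le_trans (ler_normD _ _))// lerD2r normrZ f1 mulr1 distrC ltW//.
split; last by exists l.
apply/eqP; rewrite eq_le h1 /= -(lerD2r 1) -[X in X <= _]/2 -hl.
by rewrite (le_trans (ler_normD _ _))// normrZ l1 f1 mul1r.
Qed.

(** * The functional norming the limit of the construction *)

Section generic_functional.
Variables (K : scalarField) (X : normedModType K) (Y : completeNormedModType K).
Variable G : 'L(X, Y).
Hypothesis hG : alternative_Daugavet G.

Lemma aD_norming (f : nat -> 'L(X, K^o)) (y0 : Y) :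
    (forall n, `|f n| = 1) -> `|y0| = 1 ->
  exists g : 'L(Y, K^o), [/\ `|g| <= 1, g y0 != 0 &
    forall n, exists x : X, exists w : K, [/\ `|x| <= 1, `|w| = 1 &
      2 - 2 * half K n <= `|g (G x) + w * f n x|]].
Proof.
(* The weights [a] from index [n] on add up to [half n]. With tolerance [half n / 4], step [n] loses
   at most [half n ^+ 2 / 4] in norm. *)
move=> f1 y01; pose a n := half K n.+1.
pose P (n : nat) (y : Y) (xw : X * K) := [/\ `|xw.1| <= 1, `|xw.2| = 1,
  1 - half K n / 4 <= xw.2 * f n xw.1 &
  `|y| + a n - 2 * a n * (half K n / 4) <= `|y + a n *: G xw.1|].
(* The pair [0] is a dummy where [1 <= |y|] fails; [y1] shows that the sequence never meets this
   case. *)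
have /choice[s sP] : forall ny : nat * Y, exists xw : X * K,
    1 <= `|ny.2| -> P ny.1 ny.2 xw.
  move=> [n y]; have [y1|] := boolP (1 <= `|y|); last by exists 0.
  have [|x [w xw]] := @aD_step K X Y G hG (f n) y (a n) (half K n / 4) (f1 n)
    (half_gt0 _ _) (half_le1 _ _) y1.
    by rewrite divr_gt0// half_gt0.
  by exists (x, w).
pose y := fix y n := if n is m.+1 then y m + a m *: G (s (m, y m)).1 else y0.
have yS n : y n.+1 = y n + a n *: G (s (n, y n)).1 by [].
have y1 n : 1 <= `|y n|.
  elim: n => [|n IH]; first by rewrite y01.
  have [_ _ _] := sP (n, y n) IH; rewrite -yS; apply: le_trans.
  rewrite -addrA (le_trans IH)// lerDl.
  have -> : a n - 2 * a n * (half K n / 4) = a n * (1 - half K n / 2) by field.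
  rewrite mulr_ge0 ?ltW ?half_gt0// subr_gt0 -halfS.
  by rewrite halfS ltr_pdivrMr// mul1r (le_lt_trans (half_le1 _ _))// ltr1n.
have yP n := sP (n, y n) (y1 n).
have [l lP] : exists l, forall n, `|l - y n| <= half K n.
  apply: half_cvg => n; have [x1 _ _ _] := yP n.
  rewrite yS addrC addKr normrZ gtr0_norm ?half_gt0//.
  rewrite ler_piMr ?(ltW (half_gt0 _ _))//.
  exact: le_trans (ler_ball _ (aD_norm_le1 hG)) _.
(* [`|l| <= `|y n| + half n], so the lower bound [v n <= `|l|] forces [g] to
   almost norm every increment. *)
pose v n := `|y n| + half K n - half K n ^+ 2 / 2.
(* With [p = half n], the step loses at most [p^2 / 4], while the correction [p^2 / 2] shrinks by
   [3 p^2 / 8]. *)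
have vS n : v n <= v n.+1.
  have [_ _ _] := yP n; rewrite -yS /v /a halfS -subr_ge0 => h.
  rewrite -subr_ge0; set p := half K n in h *.
  have -> : `|y n.+1| + p / 2 - (p / 2) ^+ 2 / 2 - (`|y n| + p - p ^+ 2 / 2) =
     (`|y n.+1| - (`|y n| + p / 2 - 2 * (p / 2) * (p / 4))) + p ^+ 2 / 8 by field.
  by rewrite addr_ge0// divr_ge0// exprn_ge0// ltW// half_gt0.
have vle n k : v n <= v (n + k)%N.
  by elim: k => [|k IH]; rewrite ?addn0// addnS (le_trans IH).
(* For [m = n + k], [v m <= |y m| + half m <= |l| + 2 half m], and [half m] is arbitrarily small. *)
have vl n : v n <= `|l|.
  apply/ler_addgt0Pl => e e0.
  have e20 : 0 < e / 2 by rewrite divr_gt0.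
  have [k ke] := exp_half_lt e20.
  have hk : half K (n + k) <= e / 2.
    by rewrite (le_trans (half_le _ (leq_addl n k)))// ltW.
  apply: le_trans (vle n k) _.
  have yl : `|y (n + k)%N| <= `|l| + half K (n + k).
    by rewrite -lerBlDl (le_trans (lerB_dist _ _))// distrC lP.
  rewrite -subr_ge0 /v; set p := half K (n + k) in hk yl *.
  have -> : e + `|l| - (`|y (n + k)%N| + p - p ^+ 2 / 2) =
    (`|l| + p - `|y (n + k)%N|) + (e / 2 - p) * 2 + p ^+ 2 / 2 by field.
  apply: addr_ge0; first apply: addr_ge0; first by rewrite subr_ge0.
    by rewrite mulr_ge0// subr_ge0.
  by rewrite divr_ge0// exprn_ge0// ltW// half_gt0.
have [g [g1 gl]] := hahn_banach l.
exists g; split=> // [|n].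
  (* At index 0 the bound [vl] reads [3 / 2 <= |l|], while [|g l - g y0| <= |l - y0| <= 1]. *)
  have : 1 / 2 <= `|g y0|.
    have := vl 0%N; rewrite /v y01 /half expr0 => vl0.
    have := ler_ball (l - y0) g1; rewrite linearB /= gl => gly.
    have l0 := lP 0%N; rewrite /half expr0 in l0.
    have := lerB_dist `|l| (g y0); rewrite normr_id => ll.
    rewrite -subr_ge0.
    have -> : `|g y0| - 1 / 2 = (`|l| - (1 + 1 - 1 ^+ 2 / 2)) +
      (1 - `|l - y0|) + (`|l - y0| - `| `|l| - g y0 |) +
      (`| `|l| - g y0 | - (`|l| - `|g y0|)) by field.
    apply: addr_ge0; last by rewrite subr_ge0.
    apply: addr_ge0; last by rewrite subr_ge0.
    by apply: addr_ge0; rewrite subr_ge0.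
  by apply: contraTneq => ->; rewrite normr0 -real_ltNge// ?real0// ?divr_gt0.
have [x1 w1 xw _] := yP n; set x := (s _).1 in x1 xw; set w := (s _).2 in w1 xw.
exists x, w; split=> //.
set p := half K n in xw *; have p0 : 0 < p by exact: half_gt0.
(* Here [l] is split into [y n], the increment [(p / 2) G x] and the tail [l - y n.+1], whose norm
   is at most [p / 2]. *)
have gS : (`|l| + p / 2 * (w * f n x) : K) =
    p / 2 * (g (G x) + w * f n x) + (g (y n) + g (l - y n.+1)).
  have gy : g (y n.+1) = g (y n) + p / 2 * g (G x).
    by rewrite yS -/x linearD linearZ /= /a halfS -/p.
  by rewrite -gl -[in LHS](subrK (y n.+1) l) linearD /= gy; ring.
have wr : 0 <= w * f n x.
  apply: le_trans xw; rewrite subr_ge0 ler_pdivrMr// mul1r.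
  by rewrite (le_trans (half_le1 _ _))// ler1n.
have main : `|l| + p / 2 * (w * f n x) <=
    p / 2 * `|g (G x) + w * f n x| + (`|y n| + p / 2).
  rewrite -[leLHS]ger0_norm; last by rewrite addr_ge0// mulr_ge0// divr_ge0// ltW.
  rewrite gS (le_trans (ler_normD _ _))// lerD//.
    by rewrite normrM (@gtr0_norm _ (p / 2))// divr_gt0.
  rewrite (le_trans (ler_normD _ _))// lerD ?ler_ball//.
  rewrite (le_trans (ler_ball _ g1))// -halfS lP//.
have := vl n; rewrite /v -/p => vn.
rewrite -subr_ge0.
(* [main] and [vn] bound the norm below by [1 - p + w f(x)], and [w f(x) >= 1 - p / 4]; a slack of
   [3 p / 4] remains. *)
have -> : `|g (G x) + w * f n x| - (2 - 2 * p) = (p / 2)^-1 * (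
   (p / 2 * `|g (G x) + w * f n x| + (`|y n| + p / 2) -
     (`|l| + p / 2 * (w * f n x))) + (`|l| - (`|y n| + p - p ^+ 2 / 2))) +
   (w * f n x - (1 - p / 4)) + p * (3 / 4).
  by field; rewrite gt_eqF.
apply: addr_ge0; last by rewrite mulr_ge0 ?divr_ge0 ?ltW.
apply: addr_ge0; last by rewrite subr_ge0.
apply: mulr_ge0; first by rewrite invr_ge0 divr_ge0// ltW.
by apply: addr_ge0; rewrite subr_ge0.
Qed.

(** Alternating [f1] and [f2] in one sequence makes a single [g] serve both; along each parity the
    deficit tends to 0, and [aligned_attained] makes the equality exact. *)
Lemma aD_extremal (f1 f2 : 'L(X, K^o)) (y0 : Y) :
    `|f1| = 1 -> `|f2| = 1 -> y0 != 0 ->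
  exists g : 'L(Y, K^o), [/\ `|g| <= 1, g y0 != 0 &
    exists h : 'L(X, K^o), [/\ forall x, h x = g (G x), `|h| = 1,
      exists2 w : K, `|w| = 1 & `|h + w *: f1| = 2 &
      exists2 w : K, `|w| = 1 & `|h + w *: f2| = 2]].
Proof.
move=> nf1 nf2 y00; pose f n := if odd n then f1 else f2.
have [||g [g1 gy0 gf]] := @aD_norming f (`|y0|^-1 *: y0).
- by move=> n; rewrite /f; case: odd.
- by rewrite normrZ normfV normr_id mulVf// normr_eq0.
exists g; split=> //.
  by apply: contra_neq gy0 => gy0; rewrite linearZ /= gy0 scaler0.
have [h hE hle] := operator_comp g G.
have h1 : `|h| <= 1.
  by rewrite (le_trans hle)// mulr_ile1// (aD_norm_le1 hG).
have near_f b (e : K) : 0 < e ->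
    exists2 w : K, `|w| = 1 & 2 - e <= `|h + w *: (if b then f1 else f2)|.
  move=> e0; have e20 : 0 < e / 2 by rewrite divr_gt0.
  have [N Ne] := exp_half_lt e20.
  have [x [w [x1 w1 hN]]] := gf (b + N.*2)%N; exists w => //.
  have : f (b + N.*2)%N = if b then f1 else f2.
    by rewrite /f oddD odd_double addbF; case: (b).
  move=> fE; rewrite fE in hN.
  apply: le_trans (ler_operator1 _ x1).
  rewrite operator_add operator_scale hE; apply: le_trans hN.
  rewrite lerD2l lerN2 mulrC -ler_pdivlMr//.
  apply: le_trans (ltW Ne); apply: half_le.
  by rewrite -addnn addnA leq_addl.
have [nh wf1] := aligned_attained h1 nf1 (near_f true).
have [_ wf2] := aligned_attained h1 nf2 (near_f false).
by exists h.
Qed.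

End generic_functional.

(** * Equality cases: strict convexity, smoothness and norming functionals *)

Lemma strictly_convex_eq (K : scalarField) (Z : normedModType K) (u v : Z) :
  strictly_convex Z -> `|u| <= 1 -> `|v| <= 1 -> 2 <= `|u + v| -> u = v.
Proof.
move=> sc u1 v1 uv.
have h0 : (0 : K) < 2^-1 by rewrite invr_gt0.
have uv2 : `|2^-1 *: (u + v)| = 1.
  rewrite normrZ gtr0_norm//; apply/eqP; rewrite eq_le; apply/andP; split.
    by rewrite ler_pdivrMl// mulr1 (le_trans (ler_normD _ _))// lerD.
  by rewrite ler_pdivlMl// mulr1.
have [_ zext] := sc _ uv2; apply: (zext u v 2^-1) => //.
  by rewrite h0 invf_lt1 ?ltr1n.
by rewrite scalerDr; congr (_ + _ *: _); field.
Qed.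

(** Two real parts, each at most 1, add up to 2; and 1 is the only point of the unit disc with real
    part 1. *)
Lemma ball_add_eq2 (K : scalarField) (a b : K) :
  `|a| <= 1 -> `|b| <= 1 -> a + b = 2 -> a = 1.
Proof.
case: K a b => K [] R /= a b; first by rewrite !ler_norml; lra.
move=> a1 b1 ab.
have Re1 (z : R[i]) : `|z| <= 1 -> complex.Re z <= 1.
  move=> z1; apply: le_trans (ler_norm _) _.
  by rewrite -lecR (le_trans (normc_ge_Re z)).
have : complex.Re a + complex.Re b = 2.
  by have := congr1 (@complex.Re R) ab; case: (a) (b) => [? ?] [? ?].
have := Re1 _ a1; have := Re1 _ b1 => rb ra rab.
by rewrite (@complex_eq_norm _ a 1) ?rmorph1//; lra.
Qed.

(** A functional norming [h + w *: f] splits the value 2 into two scalars of the unit disc, so both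
    equal 1. *)
Lemma norming_pair (K : scalarField) (Z : normedModType K) (h f : Z) (w : K) :
    `|h| <= 1 -> `|f| <= 1 -> `|w| = 1 -> `|h + w *: f| = 2 ->
  exists F : 'L(Z, K^o), [/\ `|F| = 1, F h = 1 & w * F f = 1].
Proof.
move=> h1 f1 w1 hf.
have [|F [F1 FE]] := @hahn_banach1 K Z (h + w *: f).
  by rewrite -normr_gt0 hf.
have Fle z : `|z| <= 1 -> `|F z| <= 1 by move=> z1; rewrite -F1 ler_operator1.
have Fsum : F h + w * F f = 2 by rewrite -hf -FE linearD linearZ.
have wf1 : `|w * F f : K| <= 1 by rewrite normrM w1 mul1r Fle.
exists F; split=> //; first exact: ball_add_eq2 (Fle _ h1) wf1 Fsum.
by apply: ball_add_eq2 wf1 (Fle _ h1) _; rewrite addrC.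
Qed.

Lemma smooth_eq (K : scalarField) (Z : normedModType K) (z : Z)
    (F F' : 'L(Z, K^o)) : smooth Z -> `|z| = 1 ->
  `|F| = 1 -> F z = 1 -> `|F'| = 1 -> F' z = 1 -> F = F'.
Proof.
move=> sm z1 F1 Fz F'1 F'z.
have [|H [_ Hu]] := sm z; first by rewrite -normr_gt0 z1.
by rewrite -(Hu F) ?z1// -(Hu F') ?z1.
Qed.

Lemma one_dimensional_injective (K : scalarField) (Z : normedModType K)
    (e : Z) (g : 'L(Z, K^o)) :
  e != 0 -> (forall z, g z = 0 -> z = 0) -> one_dimensional Z.
Proof.
move=> e0 ginj; have ge0 : g e != 0 :> K.
  by apply: contra_neq e0 => /ginj.
exists e => // z; exists ((g z : K) / g e); apply/eqP; rewrite -subr_eq0.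
apply/eqP/ginj; rewrite linearB linearZ /=.
by rewrite -[_ *: g e]/(_ * g e) divfK// subrr.
Qed.

(** If the functional norming [e] were injective, [Z] would be one-dimensional; so it kills some
    nonzero [z], which [f2] norms. The two functionals are thus not proportional. *)
Lemma separated_functionals (K : scalarField) (Z : normedModType K) (e : Z) :
    e != 0 -> ~ one_dimensional Z ->
  exists f1 f2 : 'L(Z, K^o), exists z : Z,
    [/\ `|f1| = 1, `|f2| = 1, f1 z = 0 & f2 z != 0].
Proof.
move=> e0 n1; have [f1 [nf1 f1e]] := hahn_banach1 e0.
have [f1inj|/existsNP[z /not_implyP[f1z /eqP z0]]] :=
    pselect (forall z, f1 z = 0 -> z = 0).
  by case: n1; exact: one_dimensional_injective e0 f1inj.
have [f2 [nf2 f2z]] := hahn_banach1 z0.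
by exists f1, f2, z; split=> //; rewrite f2z normr_eq0.
Qed.

Lemma functional_cross (K : scalarField) (Z : normedModType K)
  (F : 'L(Z, K^o)) (u v : Z) : F ((F u : K) *: v - (F v : K) *: u) = 0.
Proof.
have FZ (a : K) (z : Z) : F (a *: z) = a * F z by rewrite linearZ.
by rewrite linearB /= !FZ mulrC subrr.
Qed.

(** * The three cases *)

Section alternative_Daugavet_convexity.
Variables (K : scalarField) (X : normedModType K) (Y : completeNormedModType K).
Variable G : 'L(X, Y).
Hypothesis hG : alternative_Daugavet G.

Lemma aD_nonzero : exists x, G x != 0.
Proof.
have r0 : rank_one (0 : 'L(X, Y)) by exists 0 => x; exists 0; rewrite scaler0.
(* [T = 0] and [e = 1] give [0 < |G|]. *)
have [w _] := aD_approx hG r0 ltr01.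
rewrite normr0 addr0 subrr scaler0 addr0 normr_gt0 => G0.
have [//|nx] := pselect (exists x, G x != 0).
case/eqP: G0; apply/val_inj/funext => x /=.
by have [//|Gx] := eqVneq (G x) 0; case: nx; exists x.
Qed.

Lemma aD_nonzero_dom : exists x : X, x != 0.
Proof.
by have [x Gx] := aD_nonzero; exists x; apply: contra_neq Gx => ->; rewrite linear0.
Qed.

Lemma aD_strictly_convex_dom : strictly_convex (dual X) -> one_dimensional X.
Proof.
move=> sc; apply: contrapT => n1; have [e e0] := aD_nonzero_dom.
have [f1 [f2 [z [nf1 nf2 f1z /eqP]]]] := separated_functionals e0 n1; apply.
have [x Gx] := aD_nonzero.
have [g [_ _ [h [_ nh [w1 nw1 hw1] [w2 nw2 hw2]]]]] :=
  aD_extremal hG nf1 nf2 Gx.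
have hE (f : 'L(X, K^o)) (w : K) :
    `|f| = 1 -> `|w| = 1 -> `|h + w *: f| = 2 -> h = w *: f.
  move=> nf nw hw; apply: (strictly_convex_eq sc).
  - by rewrite -[X in X <= _]/`|h| nh.
  - by rewrite -[X in X <= _]/`|w *: f| normrZ nf nw mulr1.
  - by rewrite -[X in _ <= X]/`|h + w *: f| hw.
have w20 : w2 != 0 by rewrite -normr_gt0 nw2.
(* As a multiple of [f1], [h] vanishes at [z]; as a unimodular multiple of [f2], it makes [f2]
   vanish there too. *)
have : h z = 0 by rewrite (hE f1 w1)// operator_scale f1z scaler0.
rewrite (hE f2 w2)// operator_scale => /eqP.
by rewrite scaler_eq0 (negbTE w20) => /eqP.
Qed.

Lemma aD_smooth_bidual : smooth (dual X) ->
  exists F : 'L(dual X, K^o), forall f : 'L(X, K^o), `|f| = 1 -> `|F f| = 1.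
Proof.
move=> sm; have [e e0] := aD_nonzero_dom; have [x Gx] := aD_nonzero.
have [f0 [nf0 _]] := hahn_banach1 e0.
have [_ [_ _ [h1 [_ nh1 _ _]]]] := aD_extremal hG nf0 nf0 Gx.
have h10 : h1 != 0 by rewrite -normr_gt0 nh1.
have [F [nF Fh1]] := @hahn_banach1 K (dual X) h1 h10.
exists F => f nf.
have [_ [_ _ [h2 [_ nh2 [w nw h2w] [v nv h2v]]]]] := aD_extremal hG nh1 nf Gx.
have [||F1 [nF1 F1h2 F1h1]] := @norming_pair K (dual X) h2 h1 w _ _ nw h2w.
- by rewrite -[X in X <= _]/`|h2| nh2.
- by rewrite -[X in X <= _]/`|h1| nh1.
have [||F2 [nF2 F2h2 F2f]] := @norming_pair K (dual X) h2 f v _ _ nv h2v.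
- by rewrite -[X in X <= _]/`|h2| nh2.
- by rewrite -[X in X <= _]/`|f| nf.
(* [F1] and [F2] both take the value 1 at [h2], and [w *: F1] and [F] at [h1]. Smoothness at these
   two points ties [F2] to [F], which was chosen before [f]. *)
have F12 : F1 = F2 by apply: (@smooth_eq K (dual X) h2).
have FE : w *: F1 = F.
  apply: (@smooth_eq K (dual X) h1) => //.
  - by rewrite normrZ nw nF1 mulr1.
  - by rewrite Fh1.
have v0 : v != 0 by rewrite -normr_gt0 nv.
rewrite -FE F12 operator_scale normrZ nw mul1r.
by rewrite -[LHS]mul1r -nv -normrM F2f normr1.
Qed.

Lemma aD_smooth_dom : smooth (dual X) -> one_dimensional X.
Proof.
move=> /aD_smooth_bidual[F FP]; apply: contrapT => n1.
have [e e0] := aD_nonzero_dom.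
have [f1 [f2 [z [nf1 nf2 f1z /eqP]]]] := separated_functionals e0 n1; apply.
(* [k] lies in the kernel of [F], which is trivial because [F] is unimodular on the sphere; at [z],
   [k = 0] reads [F f1 * f2 z = 0]. *)
pose k : 'L(X, K^o) := (F f1 : K) *: f2 - (F f2 : K) *: f1.
have Fk : F k = 0 by exact: (functional_cross F f1 f2).
have k0 : k = 0.
  apply/eqP; have [//|k0] := eqVneq k 0.
  have := FP (`|k|^-1 *: k).
  rewrite normrZ normfV normr_id mulVf ?normr_eq0// => /(_ erefl).
  rewrite (_ : F _ = `|k|^-1 *: F k); last exact: (@linearZ K (dual X)).
  by rewrite Fk scaler0 normr0 => /eqP; rewrite eq_sym oner_eq0.
have Ff1 : (F f1 : K) != 0 by rewrite -normr_gt0 FP.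
have : k z = 0 by rewrite k0.
rewrite operator_add operator_scale -scaleNr operator_scale f1z scaler0 addr0.
by move=> /eqP; rewrite scaler_eq0 (negbTE Ff1) => /eqP.
Qed.

Lemma aD_strictly_convex_cod : strictly_convex (dual Y) -> one_dimensional Y.
Proof.
move=> sc; have [e e0] := aD_nonzero_dom; have [x Gx] := aD_nonzero.
have [f [nf _]] := hahn_banach1 e0.
have [g2 [g21 _ [h2 [h2E nh2 _ _]]]] := aD_extremal hG nf nf Gx.
apply: (one_dimensional_injective (g := g2) Gx) => y g2y.
apply/eqP; have [//|y0] := eqVneq y 0.
(* Starting the construction from [y] makes [g1 y] nonzero, and running it on [h2] aligns [h1] with
   [h2]. *)
have [g1 [g11 g1y [h1 [h1E _ [w nw h12] _]]]] := aD_extremal hG nh2 nh2 y0.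
have g12 : g1 = w *: g2.
  apply: (strictly_convex_eq sc) => //.
    by rewrite -[X in X <= _]/`|w *: g2| normrZ nw mul1r.
  (* [h1] and [h2] are [g1] and [g2] composed with [G], which maps ball into ball, so the norm 2
     passes to [g1 + w *: g2]. *)
  rewrite -[X in _ <= X]/`|g1 + w *: g2| -h12.
  apply: operator_norm_le => u u1.
  rewrite operator_add operator_scale h1E h2E.
  rewrite -[X in `|X|]/((g1 + w *: g2) (G u)) ler_operator1//.
  exact: le_trans (ler_ball _ (aD_norm_le1 hG)) u1.
by move: g1y; rewrite g12 operator_scale g2y scaler0 eqxx.
Qed.

End alternative_Daugavet_convexity.

Theorem proposition6p4 (K : scalarField) (X Y : completeNormedModType K)
    (G : 'L(X, Y)) (hG : alternative_Daugavet G) :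
  (strictly_convex (dual X) -> one_dimensional X) /\
  (smooth (dual X) -> one_dimensional X) /\
  (strictly_convex (dual Y) -> one_dimensional Y).
Proof.
split; [|split].
- exact: aD_strictly_convex_dom hG.
- exact: aD_smooth_dom hG.
- exact: aD_strictly_convex_cod hG.
Qed.
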